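(* Suppose $f:\mathbb{R}^{n+1}\to\mathbb{R}$ is $L$-smooth and satisfies the Polyak-Łojasiewicz inequality $\tfrac12\|\nabla f(x)\|^2\ge\mu_{\mathrm{PL}}(f(x)-f^\star)$ for all $x$, with $\mu_{\mathrm{PL}}>0$ and $f^\star=\inf f$, and suppose the YAND directions are T-bounded, i.e. there is $T<\infty$ with $T_k=\|\tau_k\|\le T$ for all $k$. Then the YAND iterates under exact line search satisfy $$f(x_{k+1})-f^\star\le(1-\rho_{\mathrm{exact}})(f(x_k)-f^\star),\qquad\rho_{\mathrm{exact}}=\frac{\mu_{\mathrm{PL}}}{L(1+T^2)}\in(0,1).$$ Consequently, $$f(x_k)-f^\star\le(1-\rho_{\mathrm{exact}})^k(f(x_0)-f^\star).$$
   Context: $L$-smooth means $\|\nabla f(x)-\nabla f(y)\|\le L\|x-y\|$ for all $x,y$. The function $f$ is sufficiently smooth for the affine normals below to be defined. YAND direction. At $x_k$ with $\nabla f(x_k)\ne0$ put $e_{n+1}=\nabla f(x_k)/\|\nabla f(x_k)\|$ and let $e_1,\dots,e_n$ be an orthonormal basis of $\nabla f(x_k)^\perp$ (normal-aligned frame). With $f_{ij}=D^2f(x_k)[e_i,e_j]$, $f_{n+1,i}=D^2f(x_k)[e_{n+1},e_i]$, $f_{pqi}=D^3f(x_k)[e_p,e_q,e_i]$ ($i,j,p,q\le n$) and $(f^{ij})$ the inverse of $(f_{ij})_{i,j\le n}$, the affine normal direction is, up to a nonzero scalar, $d_{\mathrm{AN}}(x_k)\propto\sum_i\big(\sum_jf^{ij}(-\frac1{n+2}\|\nabla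 f(x_k)\|\sum_{p,q}f^{pq}f_{pqj}+f_{n+1,j})\big)e_i-e_{n+1}$. The direction $d_k$ is $d_{\mathrm{AN}}(x_k)$ if $\langle\nabla f(x_k),d_{\mathrm{AN}}(x_k)\rangle<0$, $-d_{\mathrm{AN}}(x_k)$ if this inner product is $>0$, and $-\nabla f(x_k)/\|\nabla f(x_k)\|$ otherwise; it is scaled so that $d_k=\sum_{i=1}^n(\tau_k)_ie_i-e_{n+1}$ with $\tau_k\in\mathbb{R}^n$, and $T_k:=\|\tau_k\|$. YAND iterates: $x_{k+1}=x_k+\alpha_kd_k$, stopping when $\nabla f(x_k)=0$; $k$ ranges over the generated iterates. Exact line search: $\alpha_k\in\arg\min_{\alpha\ge0}f(x_k+\alpha d_k)$.
   Formalization: The claim ρ_exact in (0,1) is false for constant f (any μ_PL works) and when T=0, μ_PL=L (e.g. f=|x|²/2, where ρ=1); it is proved as ρ>0 always and, for nonconstant f, ρ≤1, with ρ<1 unless T=0 and μ_PL=L. *)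

(* Defs.v *)
From mathcomp Require Import all_boot all_order all_algebra.
From mathcomp Require Import all_classical all_reals all_analysis.

Set Implicit Arguments.
Unset Strict Implicit.
Unset Printing Implicit Defensive.

Import Order.TTheory GRing.Theory Num.Theory.
Import numFieldNormedType.Exports.
Local Open Scope ring_scope.
Local Open Scope classical_set_scope.

(* The library norm `|u| on row vectors is the sup norm; the Euclidean
   structure is therefore defined here. *)
Definition dot (R : realType) (m : nat) (u v : 'rV[R]_m) : R :=
  \sum_i u 0 i * v 0 i.

Definition l2norm (R : realType) (m : nat) (u : 'rV[R]_m) : R :=
  Num.sqrt (dot u u).

Section Smoothness.
Context (R : realType) (n : nat).
Implicit Types (f : 'rV[R]_n.+1 -> R) (x u v w : 'rV[R]_n.+1).

(* f is C^(k+1) iff it is differentiable and all its directional derivatives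
   are C^k. *)
Fixpoint class_C (k : nat) f : Prop :=
  if k is k'.+1 then
    (forall x, differentiable f x) /\ (forall v, class_C k' ('D_v f))
  else continuous f.

Definition grad f x : 'rV[R]_n.+1 := \row_i 'D_(delta_mx 0 i) f x.

(* D^2 f (x)[u, v] and D^3 f (x)[u, v, w]: for f of class C^3, iterated
   directional derivatives are the values of the higher differentials. *)
Definition D2 f x u v : R := 'D_u ('D_v f) x.
Definition D3 f x u v w : R := 'D_u ('D_v ('D_w f)) x.

Definition L_smooth (L : R) f : Prop :=
  forall x y, l2norm (grad f x - grad f y) <= L * l2norm (x - y).

Definition PL_inequality (mu : R) f : Prop :=
  forall x, mu * (f x - inf (range f)) <= 2^-1 * l2norm (grad f x) ^+ 2.

End Smoothness.

Section Yand.
Context (R : realType) (n : nat) (f : 'rV[R]_n.+1 -> R).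
Implicit Types (x d v : 'rV[R]_n.+1) (E : 'M[R]_(n, n.+1)) (tau : 'rV[R]_n).

(* The vector e_(n+1); meaningful when grad f x != 0. *)
Definition unit_grad x : 'rV[R]_n.+1 := (l2norm (grad f x))^-1 *: grad f x.

(* The rows of E are e_1, ..., e_n. *)
Definition normal_frame x E : Prop :=
  (forall i j, dot (row i E) (row j E) = (i == j)%:R) /\
  (forall i, dot (row i E) (grad f x) = 0).

Definition tangent_hessian x E : 'M[R]_n :=
  \matrix_(i, j) D2 f x (row i E) (row j E).

Definition in_frame x E tau : 'rV[R]_n.+1 :=
  \sum_i tau 0 i *: row i E - unit_grad x.

Definition affine_normal_coord x E : 'rV[R]_n :=
  let H' := invmx (tangent_hessian x E) in
  \row_i \sum_j H' i j *
    (- (n.+2%:R)^-1 * l2norm (grad f x) *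
         (\sum_p \sum_q H' p q * D3 f x (row p E) (row q E) (row j E))
     + D2 f x (unit_grad x) (row j E)).

(* invmx A is A itself when A is singular, so invertibility of the tangential
   Hessian is required explicitly: no affine normal exists without it. *)
Definition affine_normal x E v : Prop :=
  tangent_hessian x E \in unitmx /\
  exists2 c : R, c != 0 & v = c *: in_frame x E (affine_normal_coord x E).

(* The sign rule. The last case also covers a singular tangential Hessian,
   where there is no affine normal at all. *)
Variant descent_choice x E : 'rV[R]_n.+1 -> Prop :=
| ChooseAN v : affine_normal x E v -> dot (grad f x) v < 0 ->
    descent_choice x E v
| ChooseOppAN v : affine_normal x E v -> 0 < dot (grad f x) v ->
    descent_choice x E (- v)
| ChooseGrad :
    (forall v, affine_normal x E v -> dot (grad f x) v = 0) ->
    descent_choice x E (- unit_grad x).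

(* d is the YAND direction at x, normalized to have coordinate -1 along
   e_(n+1), and tau is its tangential part in the frame E. *)
Definition yand_direction x E tau d : Prop :=
  [/\ normal_frame x E,
      d = in_frame x E tau &
      exists c : R, exists v, [/\ 0 < c, descent_choice x E v & d = c *: v]].

Definition exact_line_search x d (alpha : R) : Prop :=
  0 <= alpha /\ forall a : R, 0 <= a -> f (x + alpha *: d) <= f (x + a *: d).

(* x_0, ..., x_k are actually produced: the method has not stopped before k.
   Terms of the sequences after the stopping index are irrelevant. *)
Definition generated (x : nat -> 'rV[R]_n.+1) (k : nat) : Prop :=
  forall j, (j < k)%N -> grad f (x j) != 0.

Definition yand_exact_run (x : nat -> 'rV[R]_n.+1) (E : nat -> 'M[R]_(n, n.+1))
    (tau : nat -> 'rV[R]_n) (d : nat -> 'rV[R]_n.+1) (alpha : nat -> R) : Prop :=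
  forall k, generated x k.+1 ->
    [/\ yand_direction (x k) (E k) (tau k) (d k),
        exact_line_search (x k) (d k) (alpha k) &
        x k.+1 = x k + alpha k *: d k].

(* T_k is defined only at the iterates from which a step is taken. *)
Definition T_bounded (x : nat -> 'rV[R]_n.+1) (tau : nat -> 'rV[R]_n) (T : R) :
    Prop :=
  forall k, generated x k.+1 -> l2norm (tau k) <= T.

End Yand.

Definition rho_exact (R : realType) (mu L T : R) : R := mu / (L * (1 + T ^+ 2)).

(* Main.v *)
(* In the frame, <grad f x, d> = -|grad f x| and |d|^2 = 1 + |tau|^2
   <= 1 + T^2, whatever the affine normal is. By the descent lemma the trial
   step |grad f x| / (L (1 + T^2)) decreases f by at least
   |grad f x|^2 / (2 L (1 + T^2)); the exact line search does no worse, and the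
   Polyak-Lojasiewicz inequality turns this into the contraction. The bound
   rho <= 1 comes from mu <= L, obtained by comparing that inequality with
   |grad f x|^2 <= 2 L (f x - inf f). *)
Require Import Defs.
From mathcomp Require Import all_boot all_order all_algebra.
From mathcomp Require Import all_classical all_reals all_analysis.
From mathcomp Require Import ring lra.

Set Implicit Arguments.
Unset Strict Implicit.
Unset Printing Implicit Defensive.

Import Order.TTheory GRing.Theory Num.Theory.
Import numFieldNormedType.Exports.
Local Open Scope ring_scope.
Local Open Scope classical_set_scope.

Lemma dotE (R : realType) (m : nat) (u v : 'rV[R]_m) :
  dot u v = (u *m v^T) 0 0.
Proof. by rewrite mxE; apply: eq_bigr => i _; rewrite !mxE. Qed.

Lemma dotC (R : realType) (m : nat) (u v : 'rV[R]_m) : dot u v = dot v u.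
Proof. by apply: eq_bigr => i _; rewrite mulrC. Qed.

Lemma dotBl (R : realType) (m : nat) (u v w : 'rV[R]_m) :
  dot (u - v) w = dot u w - dot v w.
Proof. by rewrite !dotE mulmxBl !mxE. Qed.

Lemma dotZl (R : realType) (m : nat) (a : R) (u v : 'rV[R]_m) :
  dot (a *: u) v = a * dot u v.
Proof. by rewrite !dotE -scalemxAl !mxE. Qed.

Lemma dotBr (R : realType) (m : nat) (u v w : 'rV[R]_m) :
  dot u (v - w) = dot u v - dot u w.
Proof. by rewrite dotC dotBl !(dotC u). Qed.

Lemma dotZr (R : realType) (m : nat) (a : R) (u v : 'rV[R]_m) :
  dot u (a *: v) = a * dot u v.
Proof. by rewrite dotC dotZl dotC. Qed.

Lemma dot_ge0 (R : realType) (m : nat) (u : 'rV[R]_m) : 0 <= dot u u.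
Proof. by apply: sumr_ge0 => i _; rewrite -expr2 sqr_ge0. Qed.

Lemma dot_eq0 (R : realType) (m : nat) (u : 'rV[R]_m) : dot u u = 0 -> u = 0.
Proof.
move=> /eqP; rewrite psumr_eq0 => [/allP u0|i _]; last by rewrite -expr2 sqr_ge0.
apply/rowP => i; rewrite mxE; apply/eqP.
by have := u0 i (mem_index_enum i); rewrite mulf_eq0 orbb.
Qed.

Lemma sqr_l2norm (R : realType) (m : nat) (u : 'rV[R]_m) :
  l2norm u ^+ 2 = dot u u.
Proof. by rewrite sqr_sqrtr // dot_ge0. Qed.

Lemma dot_gradE (R : realType) (n : nat) (f : 'rV[R]_n.+1 -> R) x v :
  differentiable f x -> 'D_v f x = dot (grad f x) v.
Proof.
move=> df; rewrite deriveE // {1}(row_sum_delta v) linear_sum /=.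
by apply: eq_bigr => i _; rewrite linearZ /= mxE deriveE // mulrC.
Qed.

Lemma is_derive_ray (R : realType) (n : nat) (f : 'rV[R]_n.+1 -> R) x d (t : R) :
  differentiable f (x + t *: d) ->
  is_derive t 1 (fun s : R => f (x + s *: d)) (dot (grad f (x + t *: d)) d).
Proof.
move=> df; rewrite -dot_gradE //.
(* Since [x + (h + t) d = h d + (x + t d)], the difference quotients of the ray at [t] are those of
   [f] along [d] at [x + t d]. *)
have quotE : (fun h : R => h^-1 *: (f (x + (h *: 1 + t) *: d) - f (x + t *: d)))
    = (fun h : R => h^-1 *: (f (h *: d + (x + t *: d)) - f (x + t *: d))).
  apply/funext => h; congr (_ *: (f _ - _)).
  by rewrite (_ : h *: 1 = h) ?scalerDl 1?addrCA //; exact: mulr1.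
have dfd : derivable f (x + t *: d) d by exact: diff_derivable.
by apply: DeriveDef; rewrite /derivable /derive /= quotE.
Qed.

(* The Lipschitz bound on the gradient gives
   [f(x + t d) - t <grad f x, d> - t^2 L |d|^2 / 2] a nonpositive derivative. *)
Lemma descent_lemma (R : realType) (n : nat) (f : 'rV[R]_n.+1 -> R) (L : R)
    x d (a : R) :
  (forall y, differentiable f y) -> 0 < L -> L_smooth L f -> 0 <= a ->
  f (x + a *: d) <=
    f x + a * dot (grad f x) d + a ^+ 2 * (2^-1 * L * dot d d).
Proof.
move=> df L0 fL a0.
set g := dot (grad f x) d; set q := 2^-1 * L * dot d d.
pose h := fun t : R => f (x + t *: d) - (t * g + t ^+ 2 * q).
pose h' := fun t : R => dot (grad f (x + t *: d)) d - (g + 2 * t * q).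
have dh (t : R) : is_derive t 1 h (h' t).
  have ? := is_derive_ray (df (x + t *: d)).
  apply: is_derive_eq; rewrite /h' /GRing.scale /=; ring.
have h'_le0 t : 0 < t -> h' t <= 0.
  move=> t0; set u := grad f (x + t *: d) - grad f x.
  have -> : h' t = dot u d - t * L * dot d d by rewrite /h' /q /u dotBl -/g; field.
  set c := t * L; have c0 : 0 < c by rewrite mulr_gt0.
  have u_le : dot u u <= c ^+ 2 * dot d d.
    rewrite -!sqr_l2norm -exprMn lerXn2r ?nnegrE ?sqrtr_ge0 //.
      by rewrite mulr_ge0 ?sqrtr_ge0 // ltW.
    have := fL (x + t *: d) x.
    rewrite {2}(addrC x) addrK /(l2norm (t *: d)) dotZl dotZr mulrA -expr2.
    by rewrite sqrtrM ?sqr_ge0 // sqrtr_sqr gtr0_norm // mulrA (mulrC L).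
  (* In place of Cauchy-Schwarz: [0 <= |u - c d|^2 <= 2 c (c |d|^2 - <u, d>)] by [u_le], and [c > 0]
     can be cancelled. *)
  have := dot_ge0 (u - c *: d); move: u c c0 u_le => u c c0 u_le.
  rewrite dotBl !dotBr !dotZl !dotZr (dotC d u) => ud.
  by rewrite -(pmulr_rle0 _ c0); nra.
have hc : continuous h.
  by move=> t; apply/differentiable_continuous/derivable1_diffP; case: (dh t).
suff : h a <= h 0.
  by rewrite /h scale0r addr0 mul0r expr0n /= mul0r addr0 subr0 lerBlDr addrA.
move: a0; rewrite le_eqVlt => /predU1P[<- //|a0].
have [|c] := MVT (f := h) (df := h') a0 (fun t _ => dh t).
  exact: continuous_subspaceT.
rewrite in_itv /= subr0 => /andP[/h'_le0 c0 _] hE.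
by rewrite -subr_le0 hE pmulr_lle0.
Qed.

(** The step [1 / L] along [- grad f x] minimizes the quadratic upper bound of the descent lemma;
    the resulting value is still at least [inf (range f)]. The lower bound on the range matters
    here: without it [inf] is a default value. *)
Lemma sqr_grad_le (R : realType) (n : nat) (f : 'rV[R]_n.+1 -> R) (L : R) x :
  (forall y, differentiable f y) -> 0 < L -> L_smooth L f ->
  has_lbound (range f) ->
  dot (grad f x) (grad f x) <= 2 * L * (f x - inf (range f)).
Proof.
move=> df L0 fL fb; set g := grad f x.
have /(descent_lemma x (- g) df L0 fL) : 0 <= L^-1 by rewrite invr_ge0 ltW.
have : inf (range f) <= f (x + L^-1 *: - g) by apply: ge_inf => //; exists (x + L^-1 *: - g).
rewrite -/g -scaleN1r !dotZr !dotZl => h1 h2; have := le_trans h1 h2.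
have -> : f x + L^-1 * (-1 * dot g g) +
    L^-1 ^+ 2 * (2^-1 * L * (-1 * (-1 * dot g g))) = f x - dot g g / (2 * L).
  by field; rewrite gt_eqF.
by rewrite lerBrDr -lerBrDl ler_pdivrMr ?mulr_gt0 // mulrC.
Qed.

(** The two gradient bounds can be divided by [f y - inf (range f)] only where this gap is positive,
    and of two distinct values one exceeds the infimum. A constant [f] satisfies the inequality for
    every [mu]. *)
Lemma PL_le_L (R : realType) (n : nat) (f : 'rV[R]_n.+1 -> R) (L mu : R) :
  (forall y, differentiable f y) -> 0 < L -> L_smooth L f ->
  has_lbound (range f) -> PL_inequality mu f ->
  (exists y z, f y <> f z) -> mu <= L.
Proof.
move=> df L0 fL fb fPL.
have infle y : inf (range f) <= f y by apply: ge_inf => //; exists y.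
have mu_le y : inf (range f) < f y -> mu <= L.
  rewrite -subr_gt0 => fy0; rewrite -(ler_pM2r fy0).
  apply: le_trans (fPL y) _; rewrite sqr_l2norm.
  by have := sqr_grad_le y df L0 fL fb; lra.
move=> [y [z fyz]]; case: (ltgtP (inf (range f)) (f y)) (infle y) => // [fy|fy] _.
  exact: (mu_le y).
apply: (mu_le z); rewrite lt_neqAle infle andbT fy.
exact/eqP.
Qed.

Lemma grad_neq0_nonconstant (R : realType) (n : nat) (f : 'rV[R]_n.+1 -> R) x :
  grad f x != 0 -> exists y z, f y <> f z.
Proof.
move=> g0; apply: contrapT => fcst; move/eqP: g0; apply.
have -> : f = cst (f x).
  by apply/funext => y; apply: contrapT => fyx; apply: fcst; exists y, x.
by apply/rowP => i; rewrite !mxE derive_cst.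
Qed.

Lemma dot_grad_in_frame (R : realType) (n : nat) (f : 'rV[R]_n.+1 -> R) x
    (E : 'M[R]_(n, n.+1)) (tau : 'rV[R]_n) :
  grad f x != 0 -> normal_frame f x E ->
  dot (grad f x) (in_frame f x E tau) = - l2norm (grad f x).
Proof.
move=> g0 [_ Eg]; rewrite /in_frame dotBr /unit_grad dotZr -sqr_l2norm.
have -> : dot (grad f x) (\sum_i tau 0 i *: row i E) = 0.
  rewrite dotC dotE mulmx_suml summxE big1 // => i _.
  by rewrite -dotE dotZl Eg mulr0.
rewrite sub0r expr2 mulKf // sqrtr_eq0 -ltNge lt_def dot_ge0 andbT.
by apply: contra_neq g0; exact: dot_eq0.
Qed.

Lemma dot_in_frame (R : realType) (n : nat) (f : 'rV[R]_n.+1 -> R) x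
    (E : 'M[R]_(n, n.+1)) (tau : 'rV[R]_n) :
  grad f x != 0 -> normal_frame f x E ->
  dot (in_frame f x E tau) (in_frame f x E tau) = 1 + l2norm tau ^+ 2.
Proof.
move=> g0 nE; have [EE Eg] := nE.
have nrm0 : l2norm (grad f x) != 0.
  by apply: contra_neq g0 => g0; apply: dot_eq0; rewrite -sqr_l2norm g0 expr0n.
(* The normal part of the left factor contributes 1 through the previous lemma; the tangential part
   is orthogonal to the gradient and leaves [|tau|^2], because [E *m E^T] is the Gram matrix of an
   orthonormal family. *)
rewrite {1}/in_frame dotBl /unit_grad dotZl dot_grad_in_frame //.
rewrite mulrN mulVf // opprK addrC; congr (_ + _).
rewrite /in_frame dotBr /unit_grad dotZr -mulmx_sum_row.
have -> : dot (tau *m E) (grad f x) = 0.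
  rewrite mulmx_sum_row dotE mulmx_suml summxE big1 // => i _.
  by rewrite -dotE dotZl Eg mulr0.
rewrite mulr0 subr0 sqr_l2norm !dotE trmx_mul mulmxA -(mulmxA tau).
suff -> : E *m E^T = 1%:M by rewrite mulmx1.
apply/matrixP => i j; rewrite !mxE -EE; apply: eq_bigr => k _.
by rewrite !mxE.
Qed.

Theorem theorem7p12 (R : realType) (n : nat) (f : 'rV[R]_n.+1 -> R)
  (L mu T : R)
  (x : nat -> 'rV[R]_n.+1) (E : nat -> 'M[R]_(n, n.+1))
  (tau : nat -> 'rV[R]_n) (d : nat -> 'rV[R]_n.+1) (alpha : nat -> R)
  (f_C3 : class_C 3 f)
  (L_gt0 : 0 < L) (f_smooth : L_smooth L f)
  (f_bounded : has_lbound (range f))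
  (mu_gt0 : 0 < mu) (f_PL : PL_inequality mu f)
  (run : yand_exact_run f x E tau d alpha)
  (tau_bounded : T_bounded f x tau T) :
  let fstar := inf (range f) in
  let rho := rho_exact mu L T in
  [/\ 0 < rho,
      (exists y z, f y <> f z) ->
        rho <= 1 /\ (~ (T = 0 /\ mu = L) -> rho < 1),
      forall k, generated f x k.+1 ->
        f (x k.+1) - fstar <= (1 - rho) * (f (x k) - fstar) &
      forall k, generated f x k ->
        f (x k) - fstar <= (1 - rho) ^+ k * (f (x 0%N) - fstar)].
Proof.
move=> fstar rho.
have df : forall y, differentiable f y by case: f_C3.
have T1 : 0 < 1 + T ^+ 2 by rewrite ltr_pwDl ?sqr_ge0.
have LT0 : 0 < L * (1 + T ^+ 2) by rewrite mulr_gt0.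
(* The value 1 does occur: for [f = L |x|^2 / 2] one may take [mu = L] and [T = 0], and a single
   step reaches the minimum. *)
have rho_bound : (exists y z, f y <> f z) ->
    rho <= 1 /\ (~ (T = 0 /\ mu = L) -> rho < 1).
  move=> /(PL_le_L df L_gt0 f_smooth f_bounded f_PL) muL.
  have LLT : L <= L * (1 + T ^+ 2) by rewrite ler_peMr ?lerDl ?sqr_ge0 // ltW.
  rewrite /rho /rho_exact ler_pdivrMr // ltr_pdivrMr // mul1r.
  split=> [|TmuL]; first exact: le_trans LLT.
  have [muL'|] := ltP mu L; first exact: lt_le_trans LLT.
  move=> Lmu; have muE : mu = L by apply/eqP; rewrite eq_le muL.
  rewrite muE ltr_pMr // ltrDl lt_def sqr_ge0 andbT sqrf_eq0.
  by apply/eqP => T0; exact: TmuL.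
have step k : generated f x k.+1 ->
    f (x k.+1) - fstar <= (1 - rho) * (f (x k) - fstar).
  move=> gk; have [[nE dE _] [_ ls] ->] := run k gk.
  (* [generated f x k.+1] includes index [k]: a step is taken from [x k]. *)
  have g0 := gk k (ltnSn k); set g := grad f (x k) in g0 *.
  have gE : dot g (d k) = - l2norm g by rewrite dE dot_grad_in_frame.
  have dT : dot (d k) (d k) <= 1 + T ^+ 2.
    (* Squaring needs [0 <= T], which follows from [0 <= |tau k| <= T]. *)
    have tT := tau_bounded k gk; have t0 : 0 <= l2norm (tau k) by exact: sqrtr_ge0.
    by rewrite dE dot_in_frame // lerD2l lerXn2r ?nnegrE // (le_trans t0).
  (* The minimizer of [- a |g| + a^2 L (1 + T^2) / 2], the descent bound with [|d k|^2] replaced by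
     [1 + T^2]. *)
  pose a := l2norm g / (L * (1 + T ^+ 2)).
  have a0 : 0 <= a by rewrite divr_ge0 ?sqrtr_ge0 // ltW.
  have := le_trans (ls _ a0) (descent_lemma (x k) (d k) df L_gt0 f_smooth a0).
  rewrite -/g gE => fa.
  have : a ^+ 2 * (2^-1 * L * dot (d k) (d k)) <=
         a ^+ 2 * (2^-1 * L * (1 + T ^+ 2)).
    by rewrite ler_wpM2l ?sqr_ge0 // ler_wpM2l // mulr_ge0 ?invr_ge0 ?ltW.
  move=> /(lerD (lexx (f (x k) + a * - l2norm g))) /(le_trans fa).
  have -> : f (x k) + a * - l2norm g + a ^+ 2 * (2^-1 * L * (1 + T ^+ 2)) =
      f (x k) - (2^-1 * l2norm g ^+ 2) / (L * (1 + T ^+ 2)).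
    by rewrite /a; field; rewrite !gt_eqF.
  have := f_PL (x k); rewrite -/g -/fstar.
  have : mu * (f (x k) - fstar) / (L * (1 + T ^+ 2)) = rho * (f (x k) - fstar).
    by rewrite /rho /rho_exact mulrAC.
  set P := 2^-1 * _ ^+ 2; set Q := L * _ => rhoE PL fk.
  suff : rho * (f (x k) - fstar) <= P / Q by lra.
  by rewrite -rhoE ler_pM2r ?invr_gt0.
split=> //; first by rewrite divr_gt0.
elim=> [|k IH] gk; first by rewrite expr0 mul1r.
(* Multiplying the induction hypothesis by [1 - rho] needs this sign; the nonzero gradient at [x k]
   rules out a constant [f]. *)
have rho1 : 0 <= 1 - rho.
  rewrite subr_ge0.
  by have [] := rho_bound (grad_neq0_nonconstant (gk k (ltnSn k))).
apply: le_trans (step k gk) _; rewrite exprS -mulrA ler_wpM2l //.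
by apply: IH => j jk; apply: gk; exact: ltnW.
Qed.
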